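(* Every non-Boolean class of idempotent $0$-semifields is not finitely based. That is, if $\mathsf{K}$ is a class of idempotent $0$-semifields such that at least one member of $\mathsf{K}$ has more than two elements, then the equational theory $\mathrm{Eq}(\mathsf{K})$ (in the signature $\{\vee,\cdot,\mathrm{e},0\}$) has no finite basis.
   Context: An idempotent semiring is an algebraic structure $\langle S,\vee,\cdot,\mathrm{e}\rangle$ such that $\langle S,\cdot,\mathrm{e}\rangle$ is a monoid, $\langle S,\vee\rangle$ is a semilattice (an idempotent commutative semigroup), and $a(b\vee c)d=abd\vee acd$ for all $a,b,c,d\in S$; it is ordered by $a\le b :\Longleftrightarrow a\vee b=b$. An idempotent $0$-semiring is an algebraic structure $\langle F,\vee,\cdot,\mathrm{e},0\rangle$ such that $\langle F,\vee,\cdot,\mathrm{e}\rangle$ is an idempotent semiring with least element $0$; it is an idempotent $0$-semifield if, additionally, $\langle F\setminus\{0\},\cdot,\mathrm{e}\rangle$ is the monoid reduct of a group. A class of idempotent $0$-semifields is non-Boolean if at least one of its members has more than two elements. Terms are built from a countably infinite set of variables; an equation $s\approx t$ is satisfied by an algebra $\mathbf{A}$ if $\varphi(s)=\varphi(t)$ for every homomorphism $\varphi$ from the term algebra to $\mathbf{A}$. $\mathrm{Eq}(\mathsf{K})$ is the set of all equations (in the signature of $\mathsf{K}$) satisfied by all members of $\mathsf{K}$. A basis for $\mathrm{Eq}(\mathsf{K})$ is a set $\Sigma\subseteq\mathrm{Eq}(\mathsf{K})$ such that every algebra of that signature satisfying $\Sigma$ satisfies $\mathrm{Eq}(\mathsf{K})$.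 $\mathsf{K}$ is finitely based if $\mathrm{Eq}(\mathsf{K})$ has a finite basis. *)

(* Defs.v *)
From mathcomp Require Import all_boot all_classical.

Set Implicit Arguments.
Unset Strict Implicit.
Unset Printing Implicit Defensive.

(* Algebras for the signature {\/, ., e, 0}, with no axioms. *)
Record zalgebra := ZAlgebra {
  carrier :> Type;
  ajoin : carrier -> carrier -> carrier;
  amul : carrier -> carrier -> carrier;
  ae : carrier;
  azero : carrier }.

Arguments ae : clear implicits.
Arguments azero : clear implicits.

Record is_monoid (S : Type) (mul : S -> S -> S) (e : S) : Prop := {
  monoidA : associative mul;
  monoid1l : left_id e mul;
  monoid1r : right_id e mul }.

Record is_semilattice (S : Type) (join : S -> S -> S) : Prop := {
  semilatticeA : associative join;
  semilatticeC : commutative join;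
  semilatticeI : forall a, join a a = a }.

Record is_idempotent_semiring (S : Type) (join mul : S -> S -> S) (e : S) :
    Prop := {
  isr_monoid : is_monoid mul e;
  isr_semilattice : is_semilattice join;
  isr_distr : forall a b c d,
    mul (mul a (join b c)) d = join (mul (mul a b) d) (mul (mul a c) d) }.

Definition join_le (S : Type) (join : S -> S -> S) (a b : S) : Prop :=
  join a b = b.

(* Only minimality of 0 is required: 0 is not assumed to be absorbing. *)
Record is_idempotent_0semiring (A : zalgebra) : Prop := {
  i0sr_semiring : is_idempotent_semiring (@ajoin A) (@amul A) (ae A);
  i0sr_least : forall a : A, join_le (@ajoin A) (azero A) a }.

(* The last three fields say that A \ {0} contains e, is closed under the
   product, and has inverses; the other group laws are inherited from A. *)
Record is_idempotent_0semifield (A : zalgebra) : Prop := {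
  i0sf_semiring : is_idempotent_0semiring A;
  i0sf_e_neq0 : ae A <> azero A;
  i0sf_mul_neq0 : forall a b : A,
    a <> azero A -> b <> azero A -> amul a b <> azero A;
  i0sf_inv : forall a : A, a <> azero A ->
    exists b : A, [/\ b <> azero A, amul a b = ae A & amul b a = ae A] }.

Inductive term : Set :=
| Var of nat
| Join of term & term
| Mul of term & term
| One
| Zero.

Definition term_algebra : zalgebra := ZAlgebra Join Mul One Zero.

Record is_hom (A B : zalgebra) (phi : A -> B) : Prop := {
  homJ : forall a b, phi (ajoin a b) = ajoin (phi a) (phi b);
  homM : forall a b, phi (amul a b) = amul (phi a) (phi b);
  hom1 : phi (ae A) = ae B;
  hom0 : phi (azero A) = azero B }.

Definition equation : Type := (term * term)%type.

Definition satisfies (A : zalgebra) (q : equation) : Prop :=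
  forall phi : term_algebra -> A, is_hom phi -> phi q.1 = phi q.2.

Definition satisfies_all (A : zalgebra) (Sigma : set equation) : Prop :=
  forall q, Sigma q -> satisfies A q.

Definition Eq (K : zalgebra -> Prop) : set equation :=
  [set q | forall A, K A -> satisfies A q]%classic.

Definition is_basis (Sigma : set equation) (K : zalgebra -> Prop) : Prop :=
  (Sigma `<=` Eq K)%classic /\
  forall A : zalgebra, satisfies_all A Sigma -> satisfies_all A (Eq K).

Definition finitely_based (K : zalgebra -> Prop) : Prop :=
  exists Sigma : set equation, finite_set Sigma /\ is_basis Sigma K.

Definition non_Boolean (K : zalgebra -> Prop) : Prop :=
  exists A : zalgebra, K A /\
    exists x y z : A, [/\ x <> y, x <> z & y <> z].

(* Main.v *)
(* Every idempotent 0-semifield satisfies, for each k,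
     x_1 ... x_k <= e \/ \/_i x_1 ... x_i^2 ... x_k.
   Conversely, fix a member of K with an element g > e. Joins of integer powers
   of g behave like max-plus integers, so an equation of Eq(K) can only assert
   that the exponents of one side lie in the convex hull of those of the other
   side, and a small equation uses few points. Let T be the set of points
   0 and (1, ..., 1) + e_i of Z^k: a simplex of k+1 vertices whose only other
   lattice point, (1, ..., 1), lies on no proper face. Thus T is closed under
   all equations of Eq(K) involving at most k points, and so the syntactic
   quotient of the sets of points of Z^k with respect to T satisfies these
   equations. The displayed inequation fails there, since its right-hand side
   evaluates to T and its left-hand side to (1, ..., 1). *)
From mathcomp Require Import all_boot all_order all_algebra all_classical zify.
Require Import Defs.

Set Implicit Arguments.
Unset Strict Implicit.
Unset Printing Implicit Defensive.

Import Order.TTheory GRing.Theory Num.Theory.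

Local Notation "x [<=] y" := (join_le (@ajoin _) x y) (at level 70).

(** * Homomorphisms from the term algebra as evaluations *)

Section TermEvaluation.

Variable A : zalgebra.

Fixpoint eval (v : nat -> A) (t : term) : A :=
  match t with
  | Var n => v n
  | Join t1 t2 => ajoin (eval v t1) (eval v t2)
  | Mul t1 t2 => amul (eval v t1) (eval v t2)
  | One => ae A
  | Zero => azero A
  end.

Lemma eval_hom (v : nat -> A) : @is_hom term_algebra A (eval v).
Proof. by []. Qed.

Lemma hom_eval (phi : term_algebra -> A) :
  is_hom phi -> phi =1 eval (fun n => phi (Var n)).
Proof.
case=> hJ hM h1 h0; elim=> [n|t1 IH1 t2 IH2|t1 IH1 t2 IH2||] //=.
- by rewrite -IH1 -IH2 -hJ.
- by rewrite -IH1 -IH2 -hM.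
Qed.

Lemma satisfies_eval (s t : term) (v : nat -> A) :
  satisfies A (s, t) -> eval v s = eval v t.
Proof. by move=> /(_ _ (eval_hom v)). Qed.

Lemma satisfies_sym (s t : term) : satisfies A (s, t) -> satisfies A (t, s).
Proof. by move=> h phi /h. Qed.

End TermEvaluation.

(** * Order and multiplication in idempotent 0-semifields *)

Section Semifield.

Variables (A : zalgebra) (hA : is_idempotent_0semifield A).

Local Notation "x * y" := (@amul A x y).
Local Notation "x \+ y" := (@ajoin A x y).
Local Notation "1" := (ae A).
Local Notation "0" := (azero A).

Let hS := i0sr_semiring (i0sf_semiring hA).

Lemma amulA : associative (@amul A).
Proof. exact: (monoidA (isr_monoid hS)). Qed.

Lemma amul1x : left_id 1 (@amul A).
Proof. exact: (monoid1l (isr_monoid hS)). Qed.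

Lemma amulx1 : right_id 1 (@amul A).
Proof. exact: (monoid1r (isr_monoid hS)). Qed.

Lemma ajoinA : associative (@ajoin A).
Proof. exact: (semilatticeA (isr_semilattice hS)). Qed.

Lemma ajoinC : commutative (@ajoin A).
Proof. exact: (semilatticeC (isr_semilattice hS)). Qed.

Lemma ajoinxx (x : A) : x \+ x = x.
Proof. exact: (semilatticeI (isr_semilattice hS)). Qed.

Lemma amulDl (x y z : A) : (x \+ y) * z = x * z \+ y * z.
Proof. by have := isr_distr hS 1 x y z; rewrite !amul1x. Qed.

Lemma amulDr (x y z : A) : x * (y \+ z) = x * y \+ x * z.
Proof. by have := isr_distr hS x y z 1; rewrite !amulx1. Qed.

Lemma ale0x (x : A) : 0 [<=] x.
Proof. exact: (i0sr_least (i0sf_semiring hA)). Qed.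

Lemma alexx (x : A) : x [<=] x.
Proof. exact: ajoinxx. Qed.

Lemma ale_trans (y x z : A) : x [<=] y -> y [<=] z -> x [<=] z.
Proof. by rewrite /join_le => xy <-; rewrite ajoinA xy. Qed.

Lemma ale_anti (x y : A) : x [<=] y -> y [<=] x -> x = y.
Proof. by rewrite /join_le ajoinC => + <-; move->. Qed.

Lemma ale_joinl (x y : A) : x [<=] x \+ y.
Proof. by rewrite /join_le ajoinA ajoinxx. Qed.

Lemma ale_joinr (x y : A) : y [<=] x \+ y.
Proof. by rewrite ajoinC; exact: ale_joinl. Qed.

Lemma ale_mul2l (x y z : A) : y [<=] z -> x * y [<=] x * z.
Proof. by rewrite /join_le -amulDr => ->. Qed.

Lemma ale_mul2r (x y z : A) : y [<=] z -> y * x [<=] z * x.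
Proof. by rewrite /join_le -amulDl => ->. Qed.

Lemma ale_mul (x x' y y' : A) : x [<=] x' -> y [<=] y' -> x * y [<=] x' * y'.
Proof. by move=> xx' yy'; apply: ale_trans (ale_mul2l x' yy'); apply: ale_mul2r. Qed.

Lemma alex0 (x : A) : x [<=] 0 -> x = 0.
Proof. by move=> /ale_anti -> //; exact: ale0x. Qed.

(** Absorption comes from minimality of [0]: if [z] is inverse to [y], multiplying [0 <= 0 * z] by
    [y] gives [0 * y <= 0]; moreover [0 * 0 <= 0 * 1 = 0]. *)
Lemma amul0x (x : A) : 0 * x = 0.
Proof.
have mul0_inv y : y <> 0 -> 0 * y = 0.
  move=> /(i0sf_inv hA) [z [_ _ zy]]; apply: alex0.
  by have := ale_mul2r y (ale0x (0 * z)); rewrite -amulA zy amulx1.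
have [->|] := pselect (x = 0); last exact: mul0_inv.
apply: alex0; rewrite -[X in _ [<=] X](mul0_inv 1); last exact: i0sf_e_neq0.
exact/ale_mul2l/ale0x.
Qed.

Lemma amulx0 (x : A) : x * 0 = 0.
Proof.
have [->|x0] := pselect (x = 0); first exact: amul0x.
have [z [_ xz _]] := i0sf_inv hA x0; apply: alex0.
by have := ale_mul2l x (ale0x (z * 0)); rewrite amulA xz amul1x.
Qed.

Definition apow (x : A) (n : nat) : A := iter n (amul x) 1.

Lemma apowS (x : A) n : apow x n.+1 = x * apow x n.
Proof. by []. Qed.

Lemma apowSr (x : A) n : apow x n.+1 = apow x n * x.
Proof.
elim: n => [|n IH]; first by rewrite /apow /= amulx1 amul1x.
by rewrite apowS {1}IH amulA.
Qed.

(* If [1 <= x^n] then [(1 \/ x)^n = x (1 \/ x)^(n-1)], and [1 \/ x] is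
   cancellable since it is above [1], hence nonzero. *)
Lemma ale1_apow (x : A) n : 1 [<=] apow x n -> (0 < n)%N -> 1 [<=] x.
Proof.
move=> h n0.
have y0 : 1 \+ x <> 0.
  by move=> e; apply: (i0sf_e_neq0 hA); apply: alex0; rewrite -e; exact: ale_joinl.
have py m : apow (1 \+ x) m <> 0.
  elim: m => [|m IH]; first exact: i0sf_e_neq0.
  by rewrite apowS; apply: i0sf_mul_neq0.
have powle m : apow x m [<=] apow (1 \+ x) m.
  elim: m => [|m IH]; first exact: alexx.
  by rewrite !apowS; apply: ale_mul => //; exact: ale_joinr.
have pow_homo m : apow (1 \+ x) m [<=] apow (1 \+ x) m.+1.
  by rewrite apowS -{1}[apow _ m]amul1x; apply: ale_mul2r; exact: ale_joinl.
(* Distributing the first factor of the right-hand side and expanding its unit part by induction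
   leaves one extra joinand, absorbed by [pow_homo]. *)
have pow1le m : 1 \+ x * apow (1 \+ x) m = apow (1 \+ x) m.+1.
  elim: m => [|m IH]; first by rewrite /apow /= !amulx1.
  by rewrite [RHS]apowS amulDl amul1x -{2}IH -ajoinA (ale_mul2l x (pow_homo m)).
case: n h n0 => // n h _.
have e : x * apow (1 \+ x) n = (1 \+ x) * apow (1 \+ x) n.
  rewrite -apowS -pow1le.
  suff : 1 [<=] x * apow (1 \+ x) n by [].
  by apply: ale_trans h _; rewrite apowS; apply: ale_mul2l.
have [z [_ ez _]] := i0sf_inv hA (py n).
have := congr1 (fun u => u * z) e; rewrite -!amulA ez !amulx1 => ->.
exact: ale_joinl.
Qed.

(** * Integer powers of an element above the unit *)

Section IntegerPowers.

Variables (g h : A).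
Hypotheses (gh : g * h = 1) (hg : h * g = 1) (g1 : 1 [<=] g) (g_neq1 : g <> 1).

Definition zpow (m : int) : A :=
  match m with Posz n => apow g n | Negz n => apow h n.+1 end.

Lemma zpowS (m : int) : zpow (1 + m)%R = g * zpow m.
Proof.
case: m => [n|[|n]]; first by rewrite -PoszD.
- by rewrite /= amulx1.
have -> : (1 + Negz n.+1 = Negz n)%R by lia.
by rewrite /= [RHS]amulA gh amul1x.
Qed.

Lemma zpowD (m n : int) : zpow (m + n)%R = zpow m * zpow n.
Proof.
elim/int_rect: m => [|m IH|m IH]; first by rewrite add0r amul1x.
- by rewrite intS -addrA !zpowS IH amulA.
- have cancel_g x y : g * x = g * y -> x = y.
    by move=> /(congr1 (amul h)); rewrite !amulA hg !amul1x.
  apply: cancel_g; rewrite amulA -!zpowS addrA.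
  by have -> : (1 - m.+1%:Z = - m%:Z)%R by lia.
Qed.

Lemma zpow_neq0 (m : int) : zpow m <> 0.
Proof.
move=> m0; apply: (i0sf_e_neq0 hA).
by rewrite -[LHS]/(zpow 0) -(subrr m) zpowD m0 amul0x.
Qed.

Lemma zpow_homo (m n : int) : (m <= n)%R -> zpow m [<=] zpow n.
Proof.
move=> mn; have -> : n = (m + `|n - m|%N%:Z)%R by lia.
rewrite zpowD -{1}[zpow m]amulx1; apply: ale_mul2l.
elim: (`|n - m|%N) => [|k IH] /=; first exact: alexx.
by rewrite -[X in X [<=] _]amulx1; apply: ale_mul.
Qed.

(** If [n < m], then [zpow (n + 1)] is squeezed between [zpow n] and [zpow m <= zpow n]; cancelling
    [zpow n] yields [g = 1]. *)
Lemma zpow_le (m n : int) : zpow m [<=] zpow n -> (m <= n)%R.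
Proof.
move=> mn; case: leP => // nm; case: g_neq1.
have e : zpow n = zpow (n + 1)%R.
  apply: ale_anti; first by apply: zpow_homo; lia.
  by apply: ale_trans mn; apply: zpow_homo; lia.
have := congr1 (amul (zpow (- n)%R)) e.
by rewrite -!zpowD addrA addNr add0r /= amulx1.
Qed.

End IntegerPowers.

End Semifield.

(** Some [a] differs from both constants. If it lies below the unit, its inverse is strictly above;
    otherwise the join of [a] with the unit is. *)
Lemma ex_gt1 (A : zalgebra) (x y z : A) :
  is_idempotent_0semifield A -> x <> y -> x <> z -> y <> z ->
  exists g h : A, [/\ amul g h = ae A, amul h g = ae A, ae A [<=] g & g <> ae A].
Proof.
move=> hA xy xz yz.
have [a [a0 a1]] : exists a : A, a <> azero A /\ a <> ae A.
  apply: contrapT => /forallNP noa.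
  have two a : a = azero A \/ a = ae A.
    by have /not_andP [/contrapT|/contrapT] := noa a; [left|right].
  by case: (two x) (two y) (two z) => ? [] ? [] ?; congruence.
have [b [b0 ab ba]] := i0sf_inv hA a0.
have [a1e|a1e] := pselect (ajoin a (ae A) = ae A).
- exists b, a; split => //.
    have := ale_mul2r hA b a1e.
    by rewrite ab (amul1x hA).
  by move=> b1; apply: a1; rewrite -ab b1 (amulx1 hA).
- have j0 : ajoin a (ae A) <> azero A.
    move=> e; apply: (i0sf_e_neq0 hA); apply: (alex0 hA); rewrite -e.
    exact: ale_joinr.
  have [c [_ jc cj]] := i0sf_inv hA j0.
  by exists (ajoin a (ae A)), c; split => //; exact: ale_joinr.
Qed.

(** * Terms as sets of exponents, and finite approximations *)

Section SetSemantics.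

Local Open Scope ring_scope.

Variable V : zmodType.

Fixpoint tset (v : nat -> set V) (t : term) : set V :=
  match t with
  | Var n => v n
  | Join t1 t2 => (tset v t1 `|` tset v t2)%classic
  | Mul t1 t2 => [set a + b | a in tset v t1 & b in tset v t2]%classic
  | One => [set 0]%classic
  | Zero => set0
  end.

(** Finite counterpart of [tset]; lists make the number of points countable by [tbound]. *)
Fixpoint tseq (w : nat -> seq V) (t : term) : seq V :=
  match t with
  | Var n => w n
  | Join t1 t2 => tseq w t1 ++ tseq w t2
  | Mul t1 t2 => [seq a + b | a <- tseq w t1, b <- tseq w t2]
  | One => [:: 0]
  | Zero => [::]
  end.

Lemma tseq_mono (w w' : nat -> seq V) t :
  (forall n, {subset w n <= w' n}) -> {subset tseq w t <= tseq w' t}.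
Proof.
move=> ww'; elim: t => [n|t1 IH1 t2 IH2|t1 IH1 t2 IH2||] r //=.
- exact: ww'.
- by rewrite !mem_cat => /orP[/IH1->|/IH2->]; rewrite ?orbT.
- case/allpairsP => -[a b] [/= /IH1 ha /IH2 hb ->].
  by apply/allpairsP; exists (a, b).
Qed.

Lemma tseq_tset (w : nat -> seq V) (v : nat -> set V) t r :
  (forall n y, y \in w n -> v n y) -> r \in tseq w t -> tset v t r.
Proof.
move=> wv; elim: t r => [n|t1 IH1 t2 IH2|t1 IH1 t2 IH2||] r //=.
- exact: wv.
- by rewrite mem_cat => /orP[/IH1|/IH2]; [left|right].
- by case/allpairsP => -[a b] [/= /IH1 ha /IH2 hb ->]; exists a => //; exists b.
- by rewrite inE => /eqP.
Qed.

Fixpoint leaves (t : term) : nat :=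
  match t with
  | Var _ => 1
  | Join t1 t2 | Mul t1 t2 => leaves t1 + leaves t2
  | One | Zero => 0
  end%N.

Fixpoint tbound (n : nat) (t : term) : nat :=
  match t with
  | Var _ => n
  | Join t1 t2 => tbound n t1 + tbound n t2
  | Mul t1 t2 => tbound n t1 * tbound n t2
  | One => 1
  | Zero => 0
  end%N.

Lemma size_tseq (w : nat -> seq V) n t :
  (forall x, size (w x) <= n)%N -> (size (tseq w t) <= tbound n t)%N.
Proof.
move=> hw; elim: t => [x|t1 IH1 t2 IH2|t1 IH1 t2 IH2||] //=.
- by rewrite size_cat leq_add.
- by rewrite size_allpairs leq_mul.
Qed.

(** Producing one point consumes at most one point per variable occurrence, so collecting these
    choices variable by variable suffices. *)
Lemma tset_finite (v : nat -> set V) t p : tset v t p ->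
  exists w : nat -> seq V, [/\ forall n y, y \in w n -> v n y,
    forall n, (size (w n) <= leaves t)%N & p \in tseq w t].
Proof.
have union t1 t2 (w1 w2 : nat -> seq V) :
    (forall n y, y \in w1 n -> v n y) -> (forall n y, y \in w2 n -> v n y) ->
    (forall n, (size (w1 n) <= leaves t1)%N) ->
    (forall n, (size (w2 n) <= leaves t2)%N) ->
    exists w : nat -> seq V, [/\ forall n y, y \in w n -> v n y,
      forall n, (size (w n) <= leaves t1 + leaves t2)%N,
      {subset tseq w1 t1 <= tseq w t1} & {subset tseq w2 t2 <= tseq w t2}].
  move=> v1 v2 s1 s2; exists (fun n => w1 n ++ w2 n); split.
  - by move=> n y; rewrite mem_cat => /orP[/v1|/v2].
  - by move=> n; rewrite size_cat leq_add.
  - by apply: tseq_mono => n y; rewrite mem_cat => ->.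
  - by apply: tseq_mono => n y; rewrite mem_cat orbC => ->.
elim: t p => [n|t1 IH1 t2 IH2|t1 IH1 t2 IH2||] p /=.
- move=> vp; exists (fun m => if m == n then [:: p] else [::]); split.
  + by move=> m y; case: eqP => [->|//]; rewrite inE => /eqP->.
  + by move=> m; case: eqP.
  + by rewrite eqxx inE.
- case=> [/IH1|/IH2] [w [vw sw pw]]; exists w; split => //.
  + by move=> n; apply: leq_trans (sw n) (leq_addr _ _).
  + by rewrite mem_cat pw.
  + by move=> n; apply: leq_trans (sw n) (leq_addl _ _).
  + by rewrite mem_cat pw orbT.
- case=> a /IH1 [w1 [v1 s1 a1]] [b /IH2 [w2 [v2 s2 b2]] <-].
  have [w [vw sw i1 i2]] := union t1 t2 w1 w2 v1 v2 s1 s2.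
  by exists w; split => //; apply/allpairsP; exists (a, b); split => //=; auto.
- by move=> ->; exists (fun=> [::]); split => //; rewrite inE.
- by [].
Qed.

Section Evaluation.

Variables (A : zalgebra) (hA : is_idempotent_0semifield A) (g h : A).
Hypotheses (gh : amul g h = ae A) (hg : amul h g = ae A).
Hypotheses (g1 : ae A [<=] g) (g_neq1 : g <> ae A).
Variables (f : V -> int) (fD : {morph f : a b / a + b}).
Variable w : nat -> seq V.

Let pow (y : V) : A := zpow g h (f y).

Definition seq_val (n : nat) : A :=
  foldr (fun y => ajoin (pow y)) (azero A) (w n).

Let powD (a b : V) : pow (a + b) = amul (pow a) (pow b).
Proof. by rewrite /pow fD (zpowD hA). Qed.

Let f0 : f 0 = 0.
Proof. by apply: (@addrI _ (f 0)); rewrite -fD !addr0. Qed.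

Lemma le_eval_seq_val t p : p \in tseq w t -> pow p [<=] eval seq_val t.
Proof.
elim: t p => [n|t1 IH1 t2 IH2|t1 IH1 t2 IH2||] p //=.
- rewrite /seq_val; elim: (w n) => //= y l IH.
  rewrite inE => /orP[/eqP->|/IH]; first exact: ale_joinl.
  by move=> /(ale_trans hA); apply; exact: ale_joinr.
- rewrite mem_cat => /orP[/IH1|/IH2] /(ale_trans hA); apply.
    exact: ale_joinl.
  exact: ale_joinr.
- case/allpairsP => -[a b] [/= /IH1 ha /IH2 hb ->].
  by rewrite powD; apply: ale_mul.
- by rewrite inE => /eqP->; rewrite /pow f0; exact: alexx.
Qed.

(** Powers of [g] form a chain, so a nonempty finite join of them is one of them; the first
    alternative accounts for empty lists. *)
Lemma eval_seq_val_max t : eval seq_val t = azero A \/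
  exists2 r, r \in tseq w t & eval seq_val t = pow r.
Proof.
have join2 (l : seq V) (a b : V) : a \in l -> b \in l ->
    exists2 r, r \in l & ajoin (pow a) (pow b) = pow r.
  move=> al bl; case: (leP (f a) (f b)) => [ab|/ltW ba].
    by exists b => //; apply: (zpow_homo hA).
  by exists a => //; rewrite (ajoinC hA); apply: (zpow_homo hA).
have join0 (x : A) : ajoin (azero A) x = x by apply: (ale0x hA).
elim: t => [n|t1 IH1 t2 IH2|t1 IH1 t2 IH2||] /=.
- rewrite /seq_val; elim: (w n) => [|y l IH] /=; first by left.
  case: IH => [->|[r rl ->]].
    by right; exists y; rewrite ?mem_head // (ajoinC hA) join0.
  by right; apply: join2; rewrite ?mem_head // inE rl orbT.
- case: IH1 IH2 => [->|[a al ->]] [->|[b bl ->]]; rewrite ?join0; first by left.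
  + by right; exists b; rewrite // mem_cat bl orbT.
  + by right; exists a; rewrite ?mem_cat ?al // (ajoinC hA) join0.
  + by right; apply: join2; rewrite mem_cat ?al ?bl ?orbT.
- case: IH1 IH2 => [->|[a al ->]] [->|[b bl ->]];
    rewrite ?(amul0x hA) ?(amulx0 hA); try by left.
  right; exists (a + b); last by rewrite powD.
  by apply/allpairsP; exists (a, b).
- by right; exists 0; rewrite ?inE // /pow f0.
- by left.
Qed.

End Evaluation.

(* Farkas-free form of: [p] is in the convex hull of few points of [tset v t]. *)
Lemma satisfies_dominated (A : zalgebra) (x y z : A) (s t : term)
    (v : nat -> set V) (p : V) :
  is_idempotent_0semifield A -> x <> y -> x <> z -> y <> z ->
  satisfies A (s, t) -> tset v s p ->
  exists R : seq V, [/\ (size R <= tbound (leaves s) t)%N,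
    forall r, r \in R -> tset v t r &
    forall f : V -> int, {morph f : a b / a + b} ->
      exists2 r, r \in R & f p <= f r].
Proof.
move=> hA xy xz yz st /tset_finite [w [wv sw pw]].
have [g [h [gh hg g1 g_neq1]]] := ex_gt1 hA xy xz yz.
(* The list is fixed before [f]: [w] depends only on [p], and [f] enters only through the powers
   assigned to its points. *)
exists (tseq w t); split; first exact: size_tseq.
  by move=> r; apply: tseq_tset.
move=> f fD.
have := le_eval_seq_val hA gh hg fD pw; rewrite (satisfies_eval _ st).
have [->|[r rt ->]] := eval_seq_val_max hA gh hg g1 fD w t.
  by move=> /(alex0 hA) /(zpow_neq0 hA gh hg).
by move=> /(zpow_le hA gh hg g1 g_neq1) ?; exists r.
Qed.

End SetSemantics.

(** * The syntactic quotient of the algebra of sets *)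

Section SyntacticAlgebra.

Local Open Scope ring_scope.
Local Open Scope classical_set_scope.

Variables (V : zmodType) (T : set V).

(** By commutativity, the contexts of [X] reduce to translations. The relation [T (u + a)] is
    symmetric, so one operator serves as both halves of the Galois connection. *)
Definition polar (X : set V) : set V := [set u | forall a, X a -> T (u + a)].

Lemma polarK (X : set V) : polar (polar (polar X)) = polar X.
Proof.
apply/seteqP; split=> u hu a Xa; last by rewrite addrC; apply: Xa.
by apply: hu => b hb; rewrite addrC; apply: hb.
Qed.

Lemma polarU (X Y : set V) : polar (X `|` Y) = polar X `&` polar Y.
Proof.
apply/seteqP; split=> u.
  by move=> hu; split=> a ha; apply: hu; [left|right].
by move=> [hX hY] a [/hX|/hY].
Qed.

Lemma polarD (X Y : set V) :
  polar [set a + b | a in X & b in Y] = [set u | forall b, Y b -> polar X (u + b)].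
Proof.
apply/seteqP; split=> u hu.
  by move=> b Yb a Xa; rewrite -addrA [b + a]addrC; apply: hu; exists a => //; exists b.
by move=> _ [a Xa [b Yb <-]]; rewrite [a + b]addrC addrA; apply: hu.
Qed.

Lemma polar_addC (X Y : set V) :
  polar [set a + b | a in X & b in Y] = polar [set a + b | a in Y & b in X].
Proof.
by congr polar; apply/seteqP; split=> _ [a ha [b hb <-]];
  exists b => //; exists a => //; rewrite addrC.
Qed.

(** Makes the product independent of representatives: by [polarD] a sum depends on its first summand
    only through the polar, and commutativity treats the second one. *)
Lemma polarD_closed (X Y : set V) :
  polar [set a + b | a in polar (polar X) & b in polar (polar Y)] =
  polar [set a + b | a in X & b in Y].
Proof.
rewrite polarD polarK -polarD polar_addC polarD polarK -polarD.
exact: polar_addC.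
Qed.

(* Two sets are identified when they have the same translates inside [T]; the
   polar of a set is a canonical name for its class. *)
Definition synt_car : Type := {X : set V | exists A, X = polar A}.

Definition cls (X : set V) : synt_car := exist _ (polar X) (ex_intro _ X erefl).

(** The bipolar, which is the largest set in the class. *)
Definition repr_cls (x : synt_car) : set V := polar (sval x).

Lemma cls_eq (X Y : set V) : cls X = cls Y <-> polar X = polar Y.
Proof. by split=> [[]//|e]; apply: eq_exist. Qed.

Lemma repr_clsK (x : synt_car) : cls (repr_cls x) = x.
Proof.
by case: x => X [A XA]; apply: eq_exist; rewrite /repr_cls /= XA polarK.
Qed.

Definition synt : zalgebra := {|
  carrier := synt_car;
  ajoin x y := cls (repr_cls x `|` repr_cls y);
  amul x y := cls [set a + b | a in repr_cls x & b in repr_cls y];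
  ae := cls [set 0];
  azero := cls set0 |}.

Lemma eval_cls (v : nat -> set V) t :
  @eval synt (fun n => cls (v n)) t = cls (tset v t).
Proof.
elim: t => [n|t1 IH1 t2 IH2|t1 IH1 t2 IH2||] //=; rewrite IH1 IH2; apply/cls_eq.
  by rewrite !polarU /repr_cls /= !polarK.
by rewrite /repr_cls /= polarD_closed.
Qed.

Lemma satisfies_synt (s t : term) :
  (forall v u, (forall p, tset v s p -> T (u + p)) <->
               (forall p, tset v t p -> T (u + p))) ->
  satisfies synt (s, t).
Proof.
move=> st phi /hom_eval phiE; rewrite !phiE /=.
have -> : (fun n => phi (Var n)) = (fun n => cls (repr_cls (phi (Var n)))).
  by apply: funext => n; rewrite repr_clsK.
by rewrite !eval_cls; apply/cls_eq/seteqP; split=> u /st.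
Qed.

(** Compare the two polars at the translation [0], which belongs to the polar of a set exactly when
    that set lies inside [T]. *)
Lemma synt_satisfies_sub (s t : term) (v : nat -> set V) :
  satisfies synt (s, t) -> (forall p, tset v t p -> T p) ->
  forall p, tset v s p -> T p.
Proof.
move=> /(@satisfies_eval synt _ _ (fun n => cls (v n))); rewrite !eval_cls => /cls_eq e ht p sp.
have : polar (tset v t) 0 by move=> r /ht; rewrite add0r.
by rewrite -e => /(_ p sp); rewrite add0r.
Qed.

End SyntacticAlgebra.

(** * The inequations and their validity in semifields *)

Definition product (l : seq nat) : term := foldr Mul One (map Var l).

(** The two pieces overlap in the variable [i], which therefore occurs twice in succession. *)
Definition square_at (k i : nat) : term :=
  product (take i.+1 (iota 0 k) ++ drop i (iota 0 k)).

(** The base [One] of the fold is the joinand e of the inequation; it later supplies the vertex 0 of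
    the simplex. *)
Definition squares (k : nat) : term :=
  foldr Join One (map (square_at k) (iota 0 k)).

Section Validity.

Variables (A : zalgebra) (hA : is_idempotent_0semifield A) (v : nat -> A).

Let ev := eval v.

Lemma eval_product_cat (l1 l2 : seq nat) :
  ev (product (l1 ++ l2)) = amul (ev (product l1)) (ev (product l2)).
Proof.
elim: l1 => [|n l1 IH]; first by rewrite /= (amul1x hA).
by rewrite /ev /= in IH *; rewrite IH (amulA hA).
Qed.

Lemma square_at_le (k i : nat) :
  (i < k)%N -> ev (square_at k i) [<=] ev (squares k).
Proof.
move=> ik; have : i \in iota 0 k by rewrite mem_iota.
rewrite /squares; elim: (iota 0 k) => //= j l IH; rewrite inE => /orP[/eqP->|/IH].
  exact: ale_joinl.
by move=> /(ale_trans hA); apply; exact: ale_joinr.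
Qed.

Lemma one_le_squares (k : nat) : ae A [<=] ev (squares k).
Proof.
rewrite /squares; elim: (iota 0 k) => [|j l IH] /=; first exact: alexx.
by apply: (ale_trans hA) IH _; exact: ale_joinr.
Qed.

(* With [w] the product and [u = w^-1 (squares k)], the factor
   [w^-1 (square_at k i)] of [u] turns the suffix of [w] after [i] into the
   suffix from [i] on. Hence [w <= u^k] and [1 <= u^(k+1)]. *)
Lemma product_le_squares (k : nat) : ev (product (iota 0 k)) [<=] ev (squares k).
Proof.
have [->|w0] := pselect (ev (product (iota 0 k)) = azero A); first exact: ale0x.
set w := ev _ in w0 *.
have [w' [w'0 ww' w'w]] := i0sf_inv hA w0.
pose u := amul w' (ev (squares k)).
have suffix j : (j <= k)%N -> ev (product (drop (k - j) (iota 0 k))) [<=] apow u j.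
  elim: j => [|j IH] jk.
    by rewrite subn0 drop_oversize ?size_iota //; exact: alexx.
  set i := (k - j.+1)%N; have ik : (i < k)%N by rewrite /i; lia.
  have ij : (k - j = i.+1)%N by rewrite /i; lia.
  rewrite ij in IH.
  have wE : w = amul (ev (product (take i.+1 (iota 0 k))))
                     (ev (product (drop i.+1 (iota 0 k)))).
    by rewrite -eval_product_cat cat_take_drop.
  set a := ev (product (take _ _)) in wE; set b := ev _ in wE IH.
  (* Since [w = a b], the element [w' a] is a left inverse of [b]; as [b] is invertible, it is also
     a right inverse. *)
  have bw'a : amul b (amul w' a) = ae A.
    have b0 : b <> azero A by move=> e; apply: w0; rewrite wE e (amulx0 hA).
    have [b' [_ bb' _]] := i0sf_inv hA b0.
    have -> : amul w' a = b'.
      have := w'w; rewrite wE => /(congr1 (fun x => amul x b')).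
      by rewrite (amul1x hA) -!(amulA hA) bb' (amulx1 hA).
    exact: bb'.
  rewrite (apowSr hA).
  have -> : ev (product (drop i (iota 0 k))) =
      amul b (amul w' (ev (square_at k i))).
    by rewrite eval_product_cat -/a !(amulA hA) -(amulA hA b) bw'a (amul1x hA).
  apply: (ale_mul hA); first by apply: IH; lia.
  exact/(ale_mul2l hA)/square_at_le.
have wu : w [<=] apow u k.
  by have := suffix k (leqnn k); rewrite subnn drop0.
(* Write the unit as [w w']: here [w <= u^k], and [w' <= u] because [squares k] lies above the
   unit. *)
have u1 : ae A [<=] u.
  apply: (ale1_apow hA (n := k.+1)) => //.
  rewrite (apowSr hA) -[X in X [<=] _]ww'; apply: (ale_mul hA) => //.
  by rewrite -[X in X [<=] _](amulx1 hA); apply/(ale_mul2l hA)/one_le_squares.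
have := ale_mul2l hA w u1.
by rewrite (amulx1 hA) /u (amulA hA) ww' (amul1x hA).
Qed.

End Validity.

Lemma satisfies_product_le_squares (A : zalgebra) (k : nat) :
  is_idempotent_0semifield A ->
  satisfies A (Join (product (iota 0 k)) (squares k), squares k).
Proof.
by move=> hA phi /hom_eval phiE; rewrite !phiE; exact: product_le_squares.
Qed.

(** * Lattice points of the simplex and failure of the inequation *)

Section Simplex.

Local Open Scope ring_scope.

Variable k : nat.

Local Notation vec := {ffun 'I_k -> int}.

(** Indexed by [nat], like the variables; it vanishes for [n >= k]. *)
Definition unit_vec (n : nat) : vec := [ffun j : 'I_k => ((j : nat) == n)%:R].

Definition all_ones : vec := [ffun=> 1].

Definition simplex : set vec :=
  [set q | q = 0 \/ exists i : 'I_k, q = all_ones + unit_vec i]%classic.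

Lemma sum_coord_eq0 (c : vec) : (forall j, 0 <= c j) -> \sum_j c j = 0 -> c = 0.
Proof.
move=> c0 cs; apply/ffunP => j; rewrite ffunE.
by have /psumr_eq0P := cs; apply.
Qed.

Lemma sum_coord_eq1 (c : vec) : (forall j, 0 <= c j) -> \sum_j c j = 1 ->
  exists i : 'I_k, c = unit_vec i.
Proof.
move=> c0 cs.
have [i ci] : exists i, c i != 0.
  apply: contrapT => /forallNP none; move: cs; rewrite big1 // => j _.
  by have /negP := none j; rewrite negbK => /eqP.
exists i; move: cs; rewrite (bigD1 i) //= => cs.
have s0 : 0 <= \sum_(j | j != i) c j by apply: sumr_ge0.
have ci1 : c i = 1.
  by move: (c i) (\sum_(j | _) _) cs s0 (c0 i) ci => a b; lia.
have : \sum_(j | j != i) c j = 0 by apply: (@addrI _ (c i)); rewrite cs ci1 addr0.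
move=> /psumr_eq0P s0'; apply/ffunP => j; rewrite ffunE.
case: (eqVneq j i) => [->|ji]; first by rewrite eqxx.
by rewrite (negPf (ji : j != i :> nat)) s0'.
Qed.

Lemma sum_unit_vec (i : 'I_k) : \sum_j unit_vec i j = 1.
Proof.
rewrite (bigD1 i) //= big1 ?addr0 => [|j ji]; rewrite ffunE ?eqxx //.
by rewrite (negPf (ji : j != i :> nat)).
Qed.

Lemma sum_all_ones : \sum_j all_ones j = k%:Z.
Proof.
under eq_bigr do rewrite ffunE.
by rewrite sumr_const card_ord natz.
Qed.

(* Only [k] points are used, so some vertex of the simplex is missing from [R];
   the inequalities place [q] on the opposite face, whose only lattice points are
   its vertices. *)
Lemma simplex_closed (R : seq vec) (q : vec) :
  (size R <= k)%N -> (forall r, r \in R -> simplex r) ->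
  (forall f : vec -> int, {morph f : a b / a + b} ->
     exists2 r, r \in R & f q <= f r) ->
  simplex q.
Proof.
move=> sR RS dom.
have domP (f : vec -> int) c : {morph f : a b / a + b} ->
    (forall r, r \in R -> f r <= c) -> f q <= c.
  by move=> fD fc; have [r rR fq] := dom f fD; apply: le_trans fq (fc r rR).
have coordD (j : 'I_k) : {morph (fun y : vec => y j) : a b / a + b}.
  by move=> a b; rewrite ffunE.
have sumD : {morph (fun y : vec => \sum_j y j) : a b / a + b}.
  by move=> a b; rewrite -big_split; apply: eq_bigr => j _; rewrite ffunE.
(* If the vertex 0 is missing, the points of [R] have coordinates at least 1 and coordinate sum
   [k + 1]. Hence so does [q], and [q - all_ones] is a unit vector. *)
have [h0|h0] := boolP (0 \in R); last first.
  have RE r : r \in R -> exists i : 'I_k, r = all_ones + unit_vec i.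
    by move=> rR; have [r0|//] := RS r rR; rewrite -r0 rR in h0.
  have sumE (i : 'I_k) : \sum_j (all_ones + unit_vec i) j = k%:Z + 1.
    by rewrite sumD sum_unit_vec sum_all_ones.
  have q1 j : 1 <= q j.
    rewrite -lerN2; apply: (domP (fun y : vec => - y j)).
      by move=> a b; rewrite coordD opprD.
    by move=> r /RE[i ->]; rewrite !ffunE; case: eqP.
  have qs : \sum_j q j = k%:Z + 1.
    apply/eqP; rewrite eq_le; apply/andP; split.
      by apply: domP sumD _ => r /RE[i ->]; rewrite sumE.
    rewrite -lerN2; apply: (domP (fun y : vec => - \sum_j y j)).
      by move=> a b; rewrite sumD opprD.
    by move=> r /RE[i ->]; rewrite sumE.
  have [||i ci] := @sum_coord_eq1 (q - all_ones).
  - by move=> j; rewrite !ffunE subr_ge0.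
  - by apply: (addIr k%:Z); rewrite -{1}sum_all_ones -sumD subrK qs addrC.
  by right; exists i; rewrite -ci addrC subrK.
(* With 0 in [R], a vertex of the other kind must be missing, for the [k + 1] vertices are
   distinct. *)
have [i iR] : exists i : 'I_k, all_ones + unit_vec i \notin R.
  apply: contrapT => /forallNP none.
  have allR (i : 'I_k) : all_ones + unit_vec i \in R.
    by have /negP := none i; rewrite negbK.
  pose vs := 0 :: [seq all_ones + unit_vec (val i) | i <- enum 'I_k].
  have : (size vs <= size R)%N.
    apply: uniq_leq_size; last first.
      by move=> r; rewrite inE => /orP[/eqP->//|/mapP[i _ ->]]; exact: allR.
    rewrite /= map_inj_uniq ?enum_uniq ?andbT.
      apply/mapP => -[i _] /ffunP/(_ i).
      by rewrite !ffunE eqxx.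
    move=> i j /addrI/ffunP/(_ i); rewrite !ffunE eqxx.
    by case: eqP => // e _; apply: val_inj.
  by rewrite /= size_map size_enum_ord; lia.
have RE r : r \in R -> r = 0 \/
    exists2 j : 'I_k, j != i & r = all_ones + unit_vec j.
  move=> rR; have [|[j rj]] := RS r rR; [by left|right].
  by exists j => //; apply: contraNneq iR => <-; rewrite -rj.
have qi0 : 0 <= q i.
  rewrite -oppr_le0; apply: (domP (fun y : vec => - y i)).
    by move=> a b; rewrite coordD opprD.
  by move=> r /RE[->|[j _ ->]]; rewrite !ffunE // oppr_le0; case: eqP.
have qi1 : q i <= 1.
  apply: (domP (fun y : vec => y i)) => // r /RE[->|[j ji ->]]; rewrite !ffunE //.
  by rewrite eq_sym (negPf (ji : j != i :> nat)).
(* Coordinate [i] is 0 at the vertex 0 and 1 at the other remaining vertices, so subtracting it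
   everywhere sends these vertices to 0 and to unit vectors. *)
pose c (y : vec) : vec := [ffun j => y j - y i].
have cD : {morph c : a b / a + b}.
  by move=> a b; apply/ffunP => j; rewrite !ffunE opprD addrACA.
have cE (j : 'I_k) : j != i -> c (all_ones + unit_vec j) = unit_vec j.
  move=> ji; apply/ffunP => l; rewrite !ffunE [i == j :> nat]eq_sym (negPf (ji : j != i :> nat)).
  by rewrite addr0 addrC addKr.
have c0E : c 0 = 0 by apply/ffunP => j; rewrite !ffunE subrr.
have cq0 j : 0 <= c q j.
  rewrite -oppr_le0; apply: (domP (fun y : vec => - c y j)).
    by move=> a b; rewrite cD coordD opprD.
  move=> r /RE[->|[l li ->]]; first by rewrite c0E ffunE.
  by rewrite cE // ffunE oppr_le0; case: eqP.
(* The equation [d y = 0] defines the hyperplane of the face opposite the missing vertex. On it,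
   [c q] is nonnegative with coordinate sum [q i], which is 0 or 1. *)
pose d (y : vec) : int := \sum_j c y j - y i.
have dD : {morph d : a b / a + b}.
  by move=> a b; rewrite /d cD sumD ffunE opprD addrACA.
have dE r : r \in R -> d r = 0.
  move=> /RE[->|[j ji ->]].
    by rewrite /d c0E ffunE subr0 big1 // => j _; rewrite ffunE.
  rewrite /d cE // sum_unit_vec !ffunE.
  by rewrite [i == j :> nat]eq_sym (negPf (ji : j != i :> nat)) addr0 subrr.
have dq : d q = 0.
  apply/eqP; rewrite eq_le; apply/andP; split.
    by apply: (domP d) => // r /dE->.
  rewrite -oppr_le0; apply: (domP (fun y => - d y)).
    by move=> a b; rewrite dD opprD.
  by move=> r /dE->.
have qE j : q j = c q j + q i by rewrite ffunE subrK.
have cqs : \sum_j c q j = q i by apply/eqP; rewrite -subr_eq0 -/(d q) dq.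
have : q i = 0 \/ q i = 1 by move: (q i) qi0 qi1 => a; lia.
case=> qi.
- left; apply/ffunP => j; rewrite qE qi addr0.
  by rewrite (sum_coord_eq0 cq0) // cqs.
- right; have [|l cl] := sum_coord_eq1 cq0; first by rewrite cqs.
  by exists l; apply/ffunP => j; rewrite qE qi cl [RHS]ffunE addrC !ffunE.
Qed.

Let unit_val (n : nat) : set vec := [set unit_vec n]%classic.

Lemma tset_product (l : seq nat) :
  tset unit_val (product l) = [set \sum_(n <- l) unit_vec n]%classic.
Proof.
elim: l => [|n l IH] /=; first by rewrite big_nil.
rewrite [foldr _ _ _]/(product l) IH big_cons; apply/seteqP; split=> q.
  by move=> [a -> [b -> <-]].
by move=> ->; exists (unit_vec n) => //; exists (\sum_(m <- l) unit_vec m).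
Qed.

Lemma sum_iota_unit_vec : \sum_(n <- iota 0 k) unit_vec n = all_ones.
Proof.
apply/ffunP => j; rewrite sum_ffunE ffunE.
have jk : val j \in iota 0 k by rewrite mem_iota /= add0n ltn_ord.
rewrite (bigD1_seq _ jk (iota_uniq _ _)) /=.
rewrite ffunE eqxx big1 ?addr0 // => n; rewrite ffunE eq_sym.
by move=> /negPf->.
Qed.

Lemma tset_square_at (i : nat) : (i < k)%N ->
  tset unit_val (square_at k i) = [set all_ones + unit_vec i]%classic.
Proof.
move=> ik; rewrite tset_product; congr (set1 _).
rewrite (take_nth 0%N) ?size_iota // nth_iota // add0n -cats1 -catA.
rewrite big_cat big_cat big_seq1 /= addrCA -big_cat cat_take_drop.
by rewrite sum_iota_unit_vec addrC.
Qed.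

Lemma tset_squares : tset unit_val (squares k) = simplex.
Proof.
have E (s : seq nat) q : tset unit_val (foldr Join One (map (square_at k) s)) q <->
    q = 0 \/ exists2 i, i \in s & tset unit_val (square_at k i) q.
  elim: s => [|n s IH] /=; first by split=> [->|[->|[]]] //; left.
  split=> [[nq|/IH[q0|[i iin iq]]]|[q0|[i]]].
  - by right; exists n; rewrite ?mem_head.
  - by left.
  - by right; exists i; rewrite // inE iin orbT.
  - by right; apply/IH; left.
  - rewrite inE => /orP[/eqP->|iin] iq; first by left.
    by right; apply/IH; right; exists i.
apply/seteqP; split=> q.
  move=> /E[->|[i]]; first by left.
  rewrite mem_iota /= => ik; rewrite tset_square_at // => ->.
  by right; exists (Ordinal ik).
move=> [->|[i ->]]; apply/E; [by left|right].
by exists (val i); rewrite ?mem_iota ?tset_square_at //= ltn_ord.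
Qed.

Lemma synt_simplex_unsat : (0 < k)%N ->
  ~ satisfies (synt simplex) (Join (product (iota 0 k)) (squares k), squares k).
Proof.
move=> k0 /(synt_satisfies_sub (v := unit_val)).
rewrite tset_squares => /(_ (fun p hp => hp) all_ones) [].
- by left; rewrite tset_product sum_iota_unit_vec.
- by move=> /ffunP/(_ (Ordinal k0)); rewrite !ffunE.
- move=> [i] /esym/eqP; rewrite -subr_eq0 addrC addKr => /eqP/ffunP/(_ i).
  by rewrite !ffunE eqxx.
Qed.

End Simplex.

(** * Transfer of small equations and conclusion *)

Local Open Scope ring_scope.

(** Each direction of the equation places a point of one side under the domination of at most [k]
    points of the other, so [simplex_closed] applies. Translation by [u] preserves domination
    because the functionals are additive. *)
Lemma satisfies_synt_simplex (A : zalgebra) (x y z : A) (k : nat) (s t : term) :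
  is_idempotent_0semifield A -> x <> y -> x <> z -> y <> z ->
  satisfies A (s, t) ->
  (tbound (leaves s) t <= k)%N -> (tbound (leaves t) s <= k)%N ->
  satisfies (synt (@simplex k)) (s, t).
Proof.
move=> hA xy xz yz st kst kts; apply: satisfies_synt => v u.
have half (s' t' : term) : satisfies A (s', t') ->
    (tbound (leaves s') t' <= k)%N -> (forall p, tset v t' p -> simplex (u + p)) ->
    forall p, tset v s' p -> simplex (u + p).
  move=> st' kst' ht p sp.
  have [R [sR RT dom]] := satisfies_dominated hA xy xz yz st' sp.
  apply: (@simplex_closed k [seq u + r | r <- R]).
  - by rewrite size_map; apply: leq_trans kst'.
  - by move=> _ /mapP[r /RT/ht ? ->].
  - move=> f fD; have [r rR fr] := dom f fD.
    by exists (u + r); [exact: map_f|rewrite !fD lerD2l].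
by split; apply: half => //; exact: satisfies_sym.
Qed.

Theorem corollary5p3 (K : zalgebra -> Prop)
  (hK : forall A : zalgebra, K A -> is_idempotent_0semifield A)
  (hnB : non_Boolean K) :
  ~ finitely_based K.
Proof.
move=> [Sigma [finSigma [SigmaK basis]]].
have [A [KA [x [y [z [xy xz yz]]]]]] := hnB.
pose bound (q : equation) :=
  (tbound (leaves q.1) q.2 + tbound (leaves q.2) q.1)%N.
have [bs bsE] : exists bs : seq nat, (bound @` Sigma = [set` bs])%classic.
  exact/finite_seqP/finite_image.
(* The successor keeps [k] positive, as [synt_simplex_unsat] requires, even when [Sigma] is
   empty. *)
pose k := (\max_(n <- bs) n).+1.
have boundk q : Sigma q -> (bound q <= k)%N.
  move=> Sq; have : ([set` bs] (bound q))%classic by rewrite -bsE; exists q.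
  by move=> /= bq; apply/leqW/(leq_bigmax_seq _ bq).
apply: (@synt_simplex_unsat k) => //; apply: basis.
- move=> [s t] Sq; have := boundk _ Sq; rewrite /bound /= => bk.
  by apply: (satisfies_synt_simplex (hK _ KA) xy xz yz (SigmaK _ Sq _ KA)); lia.
- by move=> B KB; apply: satisfies_product_le_squares; exact: hK.
Qed.
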